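(* Let $n\ge 3$ be an integer and let $n_1$ be an integer with $1\le n_1\le n-(n_1+1)$. Set $\ell_1=n-(n_1+1)$ and $\ell_3=n_1$, so that $\ell_1,\ell_3\ge 1$ and $\ell_1+\ell_3+1=n$. Suppose that $G$ is a finite solvable group whose character degree graph satisfies \[ \Delta(G)\cong K_1\vee\bigl(K_{\ell_1}\sqcup K_{\ell_3}\bigr), \] let $A$ be the adjacency matrix of $\Delta(G)$, and let $\chi_A(\lambda)=\det(\lambda I-A)$. Then the following hold. (i) The eigenvalue $-1$ of $A$ occurs with multiplicity $n-3$. (ii) The remaining three eigenvalues of $A$ are the roots of the cubic polynomial \[ \chi(\lambda)=\lambda^3-(n-3)\lambda^2+\bigl(nn_1-2n-n_1^2-n_1+3\bigr)\lambda+\bigl(2nn_1-n-2n_1^2-2n_1+1\bigr), \] and hence $\chi_A(\lambda)=(\lambda+1)^{n-3}\chi(\lambda)$. (iii) The polynomial $\chi(\lambda)$ is reducible over $\mathbb{Q}$ if and only if $n=2n_1+1$. In this case \[ \chi(\lambda)=\bigl(\lambda-(n_1-1)\bigr)\bigl(\lambda^2-(n_1-1)\lambda-2n_1\bigr), \] and the splitting field of $\chi(\lambda)$ over $\mathbb{Q}$ is a quadratic extension of $\mathbb{Q}$. (iv) If $n\ne 2n_1+1$, then $\chi(\lambda)$ is irreducible over $\mathbb{Q}$. (v) If $n\neq 2n_1+1$, the splitting field of $\chi(\lambda)$ over $\mathbb{Q}$ has degree $3$ when the discriminant $\operatorname{Disc}(\chi(\lambda))$ is a perfect square in $\mathbb{Z}$,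 and degree $6$ otherwise.
   Context: For a finite group $G$, let $\mathrm{Irr}(G)$ be the set of irreducible complex characters of $G$, $\mathrm{cd}(G)=\{\chi(1)\mid\chi\in\mathrm{Irr}(G)\}$, and let $\rho(G)$ be the set of all primes dividing some element of $\mathrm{cd}(G)$. The character degree graph $\Delta(G)$ is the simple undirected graph with vertex set $\rho(G)$ in which two distinct primes $p,q$ are adjacent if and only if $pq$ divides $\chi(1)$ for some $\chi\in\mathrm{Irr}(G)$. $K_m$ is the complete graph on $m$ vertices, $\sqcup$ is disjoint union of graphs, and $\Gamma_1\vee\Gamma_2$ is the join (disjoint union together with all edges between $\Gamma_1$ and $\Gamma_2$). *)

(* Defs.v *)
From HB Require Import structures.
From mathcomp Require Import all_boot all_order all_algebra all_fingroup.
From mathcomp Require Import all_solvable all_field all_character.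

Set Implicit Arguments.
Unset Strict Implicit.
Unset Printing Implicit Defensive.

Import Order.TTheory GRing.Theory Num.Theory.
Local Open Scope ring_scope.

Record sgraph := SGraph {
  vertex : finType;
  adj : rel vertex;
  adj_sym : symmetric adj;
  adj_irrefl : irreflexive adj }.

Definition graph_iso (Gam1 Gam2 : sgraph) : Prop :=
  exists2 f : vertex Gam1 -> vertex Gam2,
    bijective f & forall x y, adj (f x) (f y) = adj x y.

Section Constructions.

Definition complete_adj m : rel 'I_m := fun i j => i != j.

Fact complete_sym m : symmetric (@complete_adj m).
Proof. by move=> i j; rewrite /complete_adj eq_sym. Qed.

Fact complete_irrefl m : irreflexive (@complete_adj m).
Proof. by move=> i; rewrite /complete_adj eqxx. Qed.

Definition complete m := SGraph (@complete_sym m) (@complete_irrefl m).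

Variables Gam1 Gam2 : sgraph.

(* [cross] tells whether vertices of different summands are adjacent. *)
Definition sum_adj (cross : bool) : rel (vertex Gam1 + vertex Gam2) :=
  fun x y => match x, y with
    | inl a, inl b => adj a b
    | inr a, inr b => adj a b
    | _, _ => cross
    end.

Fact sum_adj_sym cross : symmetric (sum_adj cross).
Proof. by move=> [a|a] [b|b] //=; apply: adj_sym. Qed.

Fact sum_adj_irrefl cross : irreflexive (sum_adj cross).
Proof. by move=> [a|a] /=; apply: adj_irrefl. Qed.

Definition disjoint_union := SGraph (sum_adj_sym false) (sum_adj_irrefl false).
Definition join := SGraph (sum_adj_sym true) (sum_adj_irrefl true).

End Constructions.

(* Rows and columns follow the enumeration of the vertex type. *)
Definition adjacency_mx (Gam : sgraph) : 'M[rat]_#|vertex Gam| :=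
  \matrix_(i, j) (adj (enum_val i : vertex Gam) (enum_val j))%:R.

Section DegreeGraph.

Variables (gT : finGroupType) (G : {group gT}).

(* truncn loses nothing here: the values 'chi_i 1 are natural numbers. *)
Definition cd : seq nat :=
  undup [seq Num.truncn ('chi[G]_i 1%g) | i <- enum (Iirr G)].

Definition rho : seq nat := undup (flatten [seq primes d | d <- cd]).

Definition degree_adj : rel (seq_sub rho) :=
  fun p q => (p != q) && has (fun d => val p * val q %| d)%N cd.

Fact degree_adj_sym : symmetric degree_adj.
Proof. by move=> p q; rewrite /degree_adj eq_sym mulnC. Qed.

Fact degree_adj_irrefl : irreflexive degree_adj.
Proof. by move=> p; rewrite /degree_adj eqxx. Qed.

Definition degree_graph := SGraph degree_adj_sym degree_adj_irrefl.

End DegreeGraph.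

Definition complex_roots (p : {poly rat}) : seq algC :=
  sval (closed_field_poly_normal (map_poly ratr p)).

Definition eigenvalues m (A : 'M[rat]_m) : seq algC :=
  complex_roots (char_poly A).

(* With d = deg p and roots r_i: lead_coef p ^ (2d - 2) times the product of  *)
(* (r_i - r_j) ^ 2 over i < j; here 2d - 2 = 2 * (size p).-2.                 *)
Definition discriminant (p : {poly rat}) : algC :=
  let r := complex_roots p in
  ratr (lead_coef p) ^+ (2 * (size p).-2) *
  \prod_(i < size r) \prod_(j < size r | (i < j)%N) (r`_i - r`_j) ^+ 2.

Definition square_in_Z (x : algC) : Prop := exists k : int, x = k%:~R ^+ 2.

Definition reducible_poly (p : {poly rat}) : Prop :=
  exists q r : {poly rat}, [/\ (1 < size q)%N, (1 < size r)%N & p = q * r].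

Definition is_splitting_field (p : {poly rat}) (L : fieldExtType rat) : Prop :=
  splittingFieldFor 1%VS (map_poly (in_alg L) p) {: L}%VS.

(* The existence clause keeps the statement about all splitting fields from   *)
(* being vacuous.                                                             *)
Definition splitting_field_degree (p : {poly rat}) (d : nat) : Prop :=
  (exists L : fieldExtType rat, is_splitting_field p L) /\
  (forall L : fieldExtType rat, is_splitting_field p L -> \dim {: L} = d).

Definition chi_cubic (n n1 : nat) : {poly rat} :=
  let N : rat := n%:R in
  let N1 : rat := n1%:R in
  'X^3 - (N - 3) *: 'X^2
  + (N * N1 - 2 * N - N1 ^+ 2 - N1 + 3) *: 'X
  + (2 * N * N1 - N - 2 * N1 ^+ 2 - 2 * N1 + 1)%:P.

(* Main.v *)
(* Only the shape of the graph matters. Let a and b be the orders of the two  *)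
(* cliques, n = a + b + 1, b = n1. The matrix A + 1 has rank three, so        *)
(* Sylvester's determinant identity reduces det(x - (A + 1)) to x^(n-3) times *)
(* the cubic x^3 - (a+b+1) x^2 + ab x + ab, where x = lambda + 1. A rational  *)
(* root is an integer x; with p = a - x + 1 and q = b - x + 1 the equation    *)
(* becomes x (pq - 1) + (p - 1)(q - 1) = 0, which forces p = q = 1, hence     *)
(* a = b. The splitting field of an irreducible cubic with roots r, s, t has  *)
(* degree 3 or 6 as s is in Q(r) or not, and contains a square root of the    *)
(* discriminant, so that the degree is even if this root is irrational. If    *)
(* a = b, then n1 - 1 is a root and the discriminant is                       *)
(* (2 n1)^2 ((n1 + 3)^2 - 8), never a square for n1 >= 1.                     *)

Require Import Defs.
From mathcomp Require Import all_boot all_order all_algebra all_fingroup.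
From mathcomp Require Import all_solvable all_field all_character.
From mathcomp Require Import ring zify.

Set Implicit Arguments.
Unset Strict Implicit.
Unset Printing Implicit Defensive.

Import Order.TTheory GRing.Theory Num.Theory.
Local Open Scope ring_scope.

(** The spectrum comes from [char_poly_bowtie]: constancy of A + 1 on blocks reduces it to a 3 x 3
    determinant. Reducibility comes from [shifted_cubic_int_root], since a reducible cubic has a
    rational root and [root_int] makes it an integer. The degrees come from [dim_cubic_splitting],
    where [cubic_disc_square] and [cubic_disc_nonsquare] choose between its two values. *)

(** * Determinant identities *)

(** Two block eliminations of the same matrix [P]. Powers of y on both sides avoid division, as y
    will be ['X + 1]. *)
Lemma det_scalar_sub_mulmx (R : comNzRingType) n m (y : R)
    (U : 'M[R]_(n, m)) (W : 'M[R]_(m, n)) :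
  y ^+ m * \det (y%:M - U *m W) = y ^+ n * \det (y%:M - W *m U).
Proof.
pose P := block_mx y%:M U W 1%:M.
have detPr : \det P = \det (y%:M - U *m W).
  rewrite -[LHS]mulr1 -(_ : \det (block_mx 1%:M 0 (- W) 1%:M) = 1); last first.
    by rewrite det_lblock !det1 mulr1.
  rewrite -det_mulmx mulmx_block !mulmx1 !mulmx0 !mul1mx (mulmxN U W) subrr.
  by rewrite !add0r det_ublock det1 mulr1.
(* The left factor with rows (1, 0) and (-W, y) has determinant y ^ m and makes [P] block upper
   triangular. *)
rewrite -detPr -det_scalar -[X in X * _]mul1r -(det1 _ n) -(det_lblock _ (- W)).
rewrite -det_mulmx mulmx_block !mul1mx !mul0mx !addr0 mulmx1 -det_scalar.
by rewrite -scalar_mxC (mulNmx W U) (mulNmx W) addNr (addrC (- _)) det_ublock.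
Qed.

Lemma det_mx33 (R : comNzRingType) (M : 'M[R]_3) :
  \det M = M 0 0 * (M 1 1 * M 2%:R 2%:R - M 1 2%:R * M 2%:R 1)
         - M 0 1 * (M 1 0 * M 2%:R 2%:R - M 1 2%:R * M 2%:R 0)
         + M 0 2%:R * (M 1 0 * M 2%:R 1 - M 1 1 * M 2%:R 0).
Proof.
rewrite (expand_det_row _ 0) !big_ord_recl big_ord0 addr0 /cofactor.
rewrite !(expand_det_row _ ord0) !big_ord_recl !big_ord0 !addr0 /cofactor !det_mx11.
rewrite !mxE /=.
(* Natural-number indices identify the ordinals produced by the expansion with 0, 1, 2, so that
   [ring] applies. *)
pose f i j := M (inord i) (inord j).
have Mf i j : M i j = f (val i) (val j) by rewrite /f !inord_val.
rewrite !Mf /= /bump /= !addn0 /= ?(expr0, expr1, sqrrN, mulN1r, mul1r).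
ring.
Qed.

(** * The characteristic polynomial of the graph *)

Section BlockGraph.

Variables a b : nat.

Definition bowtie := join (complete 1) (disjoint_union (complete a) (complete b)).

Definition block (v : vertex bowtie) : 'I_3 :=
  match v with inl _ => 0 | inr (inl _) => 1 | inr (inr _) => 2%:R end.

Definition blocks_meet (k l : 'I_3) : bool := [|| k == 0, l == 0 | k == l].

(** Allowing equality fills the diagonal of each clique, so the relation depends on the blocks
    alone. *)
Lemma bowtie_adj v w : adj v w || (v == w) = blocks_meet (block v) (block w).
Proof.
case: v w => [i|[i|i]] [j|[j|j]] //=;
  rewrite ?ord1 // /blocks_meet eqxx orbT; exact: orNb.
Qed.

Lemma card_block l :
  (\sum_v (block v == l))%N = if l == 0 then 1%N else if l == 1 then a else b.
Proof.
rewrite big_sumType big_ord1 big_sumType /= !sum_nat_const !card_ord.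
by case: l => [] [|[|[|]]] //= ?; rewrite ?muln0 ?muln1 ?addn0.
Qed.

(* With one row per vertex and one column per block, A + 1 = U W has rank     *)
(* three, and W U is the 3 x 3 quotient matrix of A + 1.                      *)
Lemma char_poly_bowtie (Gam : sgraph) :
    graph_iso Gam bowtie ->
  ('X + 1) ^+ 3 * char_poly (adjacency_mx Gam)
    = ('X + 1) ^+ (a + b + 1)
      * (('X + 1) ^+ 3 - (a + b + 1)%:R * ('X + 1) ^+ 2 + (a * b)%:R * ('X + 1)
         + (a * b)%:R).
Proof.
case=> f bij_f adj_f; pose c (i : 'I_#|vertex Gam|) := block (f (enum_val i)).
pose U : 'M[{poly rat}]_(_, 3) := \matrix_(i, k) (c i == k)%:R.
pose W : 'M[{poly rat}]_(3, _) := \matrix_(k, j) (blocks_meet k (c j))%:R.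
(* Row i of [U] has its only 1 in column [c i], so the sum over blocks has one surviving term. *)
have defA : char_poly_mx (adjacency_mx Gam) = ('X + 1)%:M - U *m W.
  apply/matrixP=> i j; rewrite !mxE (bigD1 (c i)) //= big1 => [|k /negPf ne].
    rewrite !mxE eqxx mul1r addr0 -bowtie_adj adj_f (bij_eq bij_f).
    rewrite (inj_eq enum_val_inj) rmorph_nat.
    have [-> | _] := eqVneq i j; last by rewrite !sub0r orbF.
    by rewrite adj_irrefl mulr1n subr0 addrK.
  by rewrite !mxE eq_sym ne mul0r.
have WU k l : (W *m U) k l = (blocks_meet k l)%:R
    * (if l == 0 then 1%N else if l == 1 then a else b)%:R.
  rewrite mxE -card_block natr_sum mulr_sumr (reindex f) /=; last exact: onW_bij.
  rewrite (eq_bigr (fun j => (blocks_meet k l)%:R * (c j == l)%:R)) => [|j _].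
    by rewrite (big_enum_val
      (fun v => (blocks_meet k l)%:R * (block (f v) == l)%:R)).
  by rewrite !mxE; case: eqP => [->|_] //; rewrite !mulr0.
have E k l : (('X + 1)%:M - W *m U) k l
    = ('X + 1) *+ (k == l) - (blocks_meet k l)%:R
      * (if l == 0 then 1%N else if l == 1 then a else b)%:R.
  by rewrite -WU !mxE.
have cardV : #|vertex Gam| = (a + b + 1)%N.
  by rewrite (bij_eq_card bij_f) !card_sum !card_ord addnC.
rewrite /char_poly defA det_scalar_sub_mulmx.
congr (_ ^+ _ * _) => //.
by rewrite det_mx33 !E /blocks_meet /=; ring.
Qed.

End BlockGraph.

(** Written in powers of ['X + 1], the cubic is visibly symmetric in a and b. *)
Lemma chi_cubicE a b : chi_cubic (a + b + 1) b
  = ('X + 1) ^+ 3 - (a + b + 1)%:R * ('X + 1) ^+ 2 + (a * b)%:R * ('X + 1)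
    + (a * b)%:R.
Proof. by rewrite /chi_cubic -!mul_polyC; ring. Qed.

Lemma char_poly_bowtieE a b (Gam : sgraph) : (2 <= a + b)%N ->
    graph_iso Gam (bowtie a b) ->
  char_poly (adjacency_mx Gam)
    = ('X + 1) ^+ (a + b + 1 - 3) * chi_cubic (a + b + 1) b.
Proof.
move=> ab_ge2 /char_poly_bowtie; rewrite -chi_cubicE.
have ->: ('X + 1) ^+ (a + b + 1)
    = ('X + 1) ^+ 3 * ('X + 1) ^+ (a + b + 1 - 3) :> {poly rat}.
  by rewrite -exprD subnKC ?addn1.
rewrite -[RHS]mulrA => /mulfI-> //.
by rewrite expf_neq0 // -[1]opprK -polyCN polyXsubC_eq0.
Qed.

(** * Monic cubics and their discriminant *)

Definition cubic (R : nzRingType) (u v w : R) : {poly R} :=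
  'X^3 + u *: 'X^2 + v *: 'X + w%:P.

Lemma coef_cubic (R : nzRingType) (u v w : R) i :
  (cubic u v w)`_i = if i == 0%N then w else if i == 1%N then v
                     else if i == 2%N then u else (i == 3%N)%:R.
Proof.
rewrite /cubic !coefD !coefZ coefC !coefXn coefX.
by case: i => [|[|[|[|i]]]] /=; rewrite ?mulr0 ?mulr1 ?addr0 ?add0r.
Qed.

Lemma size_cubic (R : nzRingType) (u v w : R) : size (cubic u v w) = 4.
Proof.
apply/eqP; rewrite eqn_leq; apply/andP; split.
  by apply/leq_sizeP=> -[|[|[|[|j]]]] // _; rewrite coef_cubic.
rewrite ltnNge; apply/negP=> /leq_sizeP/(_ 3%N (leqnn _))/eqP.
by rewrite coef_cubic oner_eq0.
Qed.

Lemma monic_cubic (R : nzRingType) (u v w : R) : cubic u v w \is monic.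
Proof. by rewrite monicE lead_coefE size_cubic coef_cubic. Qed.

Lemma map_cubic (R S : nzRingType) (f : {rmorphism R -> S}) u v w :
  map_poly f (cubic u v w) = cubic (f u) (f v) (f w).
Proof. by rewrite !rmorphD /= !map_polyZ map_polyX !map_polyXn map_polyC. Qed.

Lemma horner_cubic (R : comNzRingType) (u v w x : R) :
  (cubic u v w).[x] = x ^+ 3 + u * x ^+ 2 + v * x + w.
Proof. by rewrite /cubic !hornerE. Qed.

Lemma complex_roots_prod (p : {poly rat}) : p \is monic ->
  map_poly ratr p = \prod_(z <- complex_roots p) ('X - z%:P).
Proof.
move=> mon_p; rewrite /complex_roots; case: closed_field_poly_normal => s /=.
by rewrite lead_coef_map (monicP mon_p) rmorph1 scale1r.
Qed.

Lemma perm_complex_roots (p : {poly rat}) s : p \is monic ->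
  map_poly ratr p = \prod_(z <- s) ('X - z%:P) -> perm_eq (complex_roots p) s.
Proof. by move=> /complex_roots_prod-> /prod_XsubC_eq. Qed.

Lemma cubic_prod (R : comNzRingType) (r s t : R) :
  \prod_(z <- [:: r; s; t]) ('X - z%:P)
    = cubic (- (r + s + t)) (r * s + r * t + s * t) (- (r * s * t)).
Proof. by rewrite !big_cons big_nil /cubic -!mul_polyC; ring. Qed.

Lemma cubic_inj (R : nzRingType) (u v w u' v' w' : R) :
  cubic u v w = cubic u' v' w' -> [/\ u = u', v = v' & w = w'].
Proof.
move=> eq_p; have eq_c i := congr1 (fun p : {poly R} => p`_i) eq_p.
by split; [move: (eq_c 2%N) | move: (eq_c 1%N) | move: (eq_c 0%N)];
  rewrite !coef_cubic.
Qed.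

(** A polynomial in the coefficients, hence an element of the base field that commutes with
    embeddings. *)
Definition cubic_disc (R : comNzRingType) (u v w : R) : R :=
  u ^+ 2 * v ^+ 2 - 4 * v ^+ 3 - 4 * u ^+ 3 * w + 18 * u * v * w - 27 * w ^+ 2.

Lemma cubic_prod_disc (R : comNzRingType) (u v w r s t : R) :
    cubic u v w = \prod_(z <- [:: r; s; t]) ('X - z%:P) ->
  ((r - s) * (r - t) * (s - t)) ^+ 2 = cubic_disc u v w.
Proof.
rewrite cubic_prod => /cubic_inj[-> -> ->]; rewrite /cubic_disc; ring.
Qed.

Lemma cubic_split (F : fieldType) (u v w : F) rs :
    cubic u v w = \prod_(z <- rs) ('X - z%:P) ->
  exists r s t, rs = [:: r; s; t].
Proof.
move=> /(congr1 (fun p : {poly F} => size p)); rewrite size_cubic size_prod_XsubC.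
by case: rs => [|r [|s [|t []]]] // _; exists r, s, t.
Qed.

Lemma discriminant_cubic (u v w : rat) :
  discriminant (cubic u v w) = ratr (cubic_disc u v w).
Proof.
have := complex_roots_prod (monic_cubic u v w); rewrite map_cubic => defp.
have [r [s [t rsE]]] := cubic_split defp.
rewrite /discriminant (monicP (monic_cubic u v w)) rmorph1 expr1n mul1r rsE.
rewrite rsE in defp; have := cubic_prod_disc defp.
rewrite /= !big_ord_recl !big_ord0 /= !big_mkcond /= !big_ord_recl !big_ord0 /=.
rewrite !big_mkcond /= !big_ord_recl !big_ord0 /= !mulr1 !mul1r => DE.
have -> : ratr (cubic_disc u v w) = cubic_disc (ratr u : algC) (ratr v) (ratr w).
  by rewrite /cubic_disc; ring.
by rewrite -DE big_mkcond !big_ord_recl big_ord0 /=; ring.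
Qed.

(** * Integer and rational roots *)

Lemma shifted_cubic_int_root (a b x : int) : 0 < a -> 0 < b ->
  x ^+ 3 - (a + b + 1) * x ^+ 2 + a * b * x + a * b = 0 -> a = b.
Proof.
move=> a_gt0 b_gt0 eq0; have ab_gt0 : 0 < a * b by rewrite mulr_gt0.
(* For x < 0 the left side of [E] is positive, forcing x + 1 > 0; x = 0 would give ab = 0. *)
have x_gt0 : 0 < x.
  rewrite ltNge; apply/negP=> x_le0.
  have E : x ^+ 2 * (a + b + 1 - x) = a * b * (x + 1).
    by apply/eqP; rewrite -subr_eq0 -oppr_eq0 -eq0; apply/eqP; ring.
  have [x0|x_lt0] := eqVneq x 0; first by rewrite x0 in E; lia.
  have : 0 < x ^+ 2 * (a + b + 1 - x) by rewrite mulr_gt0 ?exprn_even_gt0 //; lia.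
  by rewrite E pmulr_rgt0 //; lia.
(* Times x + 1, the equation reads ((x+1)a - x^2)((x+1)b - x^2) = x^2; both   *)
(* factors are -1 mod x + 1, namely (x+1)p - 1 and (x+1)q - 1.                *)
pose p := a - x + 1; pose q := b - x + 1.
have pqE : x * (p * q - 1) + (p - 1) * (q - 1) = 0.
  by rewrite -[RHS]eq0 /p /q; ring.
suff : p = q by rewrite /p /q; lia.
(* This and [qx] are a > 0 and b > 0, kept for when p and q become arbitrary. *)
have px : p + x > 1 by rewrite /p; lia.
have qx : q + x > 1 by rewrite /q; lia.
move: p q => p q in pqE px qx *.
(* If both are nonpositive, then pq = 0 and the equation contradicts [px] or [qx]. Mixed signs make
   the left side negative. If both are positive, its two terms are nonnegative, so p = q = 1. *)
have [p_le0|p_gt0] := lerP p 0; have [q_le0|q_gt0] := lerP q 0.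
- have : p * q - 1 < 0.
    rewrite ltNge; apply/negP => pq.
    have : 0 <= x * (p * q - 1) by rewrite mulr_ge0 // ltW.
    have : 0 < (p - 1) * (q - 1) by rewrite nmulr_rgt0; lia.
    lia.
  move=> pq_lt1; have /eqP : p * q = 0 by nia.
  by rewrite mulf_eq0 => /orP[] /eqP z; rewrite z in pqE px qx *; lia.
- nia.
- nia.
- nia.
Qed.

(** The root is an algebraic integer, and a rational algebraic integer is an integer. *)
Lemma root_int (p : {poly rat}) x : p \is monic -> p \is a polyOver Num.int ->
  root p x -> x \is a Num.int.
Proof.
move=> mon_p int_p rt.
have Cx : (ratr x : algC) \is a Num.int.
  apply: Cint_rat_Aint; first exact: Crat_rat.
  apply: (@root_monic_Aint (map_poly ratr p)); rewrite ?fmorph_root ?map_monic //.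
  apply/polyOverP=> i; rewrite coef_map /=.
  by have /intrP[k ->] := polyOverP int_p i; rewrite ratr_int intr_int.
have /intrP[k] := Cx; rewrite -(ratr_int algC) => /fmorph_inj->.
exact: intr_int.
Qed.

(** * Degrees of splitting fields *)

(** The complex roots generate a number field; the factorization is pulled back along its embedding
    in [algC]. *)
Lemma splitting_field_exists (p : {poly rat}) : p \is monic ->
  exists L : fieldExtType rat, is_splitting_field p L.
Proof.
move=> mon_p; have [L [f [rs rsE genL]]] := num_field_exists (complex_roots p).
exists L, rs => //; suff -> : map_poly (in_alg L) p = \prod_(z <- rs) ('X - z%:P).
  exact: eqpxx.
apply: (map_poly_inj f); rewrite -map_poly_comp map_prod_XsubC -[rs in RHS]map_id.
rewrite map_id -(big_map f predT (fun z => 'X - z%:P)) rsE -complex_roots_prod //.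
exact/eq_map_poly/fmorph_eq_rat.
Qed.

Lemma dim_adjoin_irreducible (F : fieldType) (L : fieldExtType F) (p : {poly F})
    (x : L) :
  irreducible_poly p -> root (map_poly (in_alg L) p) x ->
  \dim <<1; x>> = (size p).-1.
Proof.
move=> irr_p px0; have /polyOver1P[q qE] := minPolyOver 1%AS x.
have szq := size_minPoly 1 x; rewrite qE size_map_poly in szq.
have q_p : q %| p.
  rewrite -(dvdp_map (in_alg L)) -qE minPoly_dvdp //.
  by apply/polyOver1P; exists p.
by rewrite (dim_Fadjoin 1%AS) dimv1 muln1
  -(eqp_size (apply_irredp irr_p _ q_p)) szq.
Qed.

Lemma adjoin_degree_le (F : fieldType) (L : fieldExtType F) (K : {subfield L})
    (p : {poly L}) (x : L) :
  p \is a polyOver K -> p != 0 -> root p x -> (adjoin_degree K x < size p)%N.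
Proof.
move=> Kp p_neq0 px0; rewrite -size_minPoly.
by apply: dvdp_leq p_neq0 _; apply: minPoly_dvdp.
Qed.

(** x is a root of X^2 - (x + y) X + xy, whose coefficients lie in K. *)
Lemma adjoin_degree_quadratic (F : fieldType) (L : fieldExtType F)
    (K : {subfield L}) (x y : L) : x + y \in K -> x * y \in K ->
  adjoin_degree K x = if x \in K then 1%N else 2.
Proof.
move=> Ks Kp; case: ifPn => [|Kx]; first by rewrite -adjoin_deg_eq1 => /eqP.
have E : ('X - x%:P) * ('X - y%:P) = 'X^2 - (x + y)%:P * 'X + (x * y)%:P.
  by ring.
have sz : size (('X - x%:P) * ('X - y%:P)) = 3.
  by rewrite size_mul ?polyXsubC_eq0 // !size_XsubC.
have := @adjoin_degree_le F L K (('X - x%:P) * ('X - y%:P)) x.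
rewrite -size_poly_eq0 sz rootM root_XsubC eqxx E => /(_ _ isT isT).
rewrite rpredD ?rpredB ?rpredM ?polyOverXn ?polyOverX ?polyOverC // => /(_ isT).
by move: Kx; rewrite -adjoin_deg_eq1 /adjoin_degree; case: _.-1 => [|[|]].
Qed.

Lemma splitting_field_root (F : fieldType) (L : fieldExtType F) (p : {poly L})
    (E : {vspace L}) :
  (1 < size p)%N -> splittingFieldFor 1%VS p E -> exists x, root p x.
Proof.
move=> p_gt1 [rs Dp _]; move: p_gt1; rewrite (eqp_size Dp) size_prod_XsubC.
case: rs Dp => // x rs Dp _.
by exists x; rewrite (eqp_root Dp) root_prod_XsubC mem_head.
Qed.

Section CubicSplittingField.

Variables (F : fieldType) (u v w : F) (L : fieldExtType F).
Let p := cubic u v w.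

(** Any chosen root can be listed first: permuting the roots changes neither the product nor the
    generated field. *)
Lemma cubic_splitting_roots x :
    splittingFieldFor 1%VS (map_poly (in_alg L) p) {: L}%VS ->
    root (map_poly (in_alg L) p) x ->
  exists s t, map_poly (in_alg L) p = \prod_(z <- [:: x; s; t]) ('X - z%:P)
    /\ <<1 & [:: x; s; t]>>%VS = fullv.
Proof.
case=> rs + gen_rs; rewrite eqp_monic ?map_monic ?monic_cubic ?monic_prod_XsubC //.
move=> /eqP pE; rewrite pE root_prod_XsubC => x_rs.
have /perm_to_rem xrs := x_rs; have szrs := perm_size xrs.
have := pE; rewrite map_cubic => /cubic_split[r [s0 [t0 rsE]]].
case: (rem x rs) szrs xrs => [|s [|t []]]; rewrite {1}rsE // => _ xrs.
exists s, t; split; first exact: perm_big.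
by rewrite -gen_rs (eq_span (perm_mem xrs)).
Qed.

Variables r s t : L.
Hypothesis pE : map_poly (in_alg L) p = \prod_(z <- [:: r; s; t]) ('X - z%:P).

Let coefE : u%:A = - (r + s + t) /\ v%:A = r * s + r * t + s * t.
Proof. by move: pE; rewrite map_cubic cubic_prod => /cubic_inj[]. Qed.

Let A_K (E : {subfield L}) x : x%:A \in E.
Proof. by rewrite rpredZ ?mem1v. Qed.

Let K := <<1; r>>%AS.

Let Kr : r \in K.
Proof. exact: memv_adjoin. Qed.

Let Kst : s + t \in K.
Proof.
have -> : s + t = - (r + u%:A) by have [-> _] := coefE; ring.
by rewrite rpredN rpredD ?A_K.
Qed.

(** Over F(r), s and t have sum -(r + u) and product v - r (s + t), so s has degree at most 2 and
    brings t with it. *)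
Lemma dim_cubic_splitting : <<1 & [:: r; s; t]>>%VS = fullv ->
  \dim {: L} = ((if s \in <<1; r>>%VS then 1 else 2) * \dim <<1; r>>)%N.
Proof.
have [_ vE] := coefE.
rewrite !adjoin_cons => <-; rewrite Fadjoin_nil.
have tE : <<<<K; s>>; t>>%VS = <<K; s>>%VS.
  apply/Fadjoin_idP; have -> : t = (s + t) - s by ring.
  by rewrite rpredB ?memv_adjoin // (subvP (subv_adjoin _ _)).
transitivity (\dim <<K; s>>).
  exact: (congr1 (fun V : {vspace L} => \dim V) tE).
rewrite dim_Fadjoin (@adjoin_degree_quadratic _ _ _ _ t) //.
have -> : s * t = v%:A - r * (s + t) by rewrite vE; ring.
by rewrite rpredB ?rpredM ?A_K.
Qed.

(** The product is p'(r). As 3 is nonzero, p' is a nonzero polynomial of degree at most 2, whereas r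
    has degree 3. *)
Lemma irreducible_cubic_simple_root :
  3%:R != 0 :> F -> irreducible_poly p ->
  (r - s) * (r - t) != 0.
Proof.
move=> three_neq0 irr_p; have szp : size p = 4 := size_cubic u v w.
have rt : root (map_poly (in_alg L) p) r.
  by rewrite pE root_prod_XsubC mem_head.
have := dim_adjoin_irreducible irr_p rt.
rewrite (dim_Fadjoin 1%AS) dimv1 muln1 szp => deg_r.
have dE : (map_poly (in_alg L) p^`()).[r] = (r - s) * (r - t).
  rewrite -deriv_map pE !big_cons big_nil mulr1 !derivE !hornerE subrr; ring.
apply/negP=> /eqP z; have p'_neq0 : p^`() != 0.
  apply: contra_neq three_neq0 => /(congr1 (fun q : {poly F} => q`_2)).
  by rewrite coef_deriv coef_cubic coef0.
have := @adjoin_degree_le _ _ 1%AS (map_poly (in_alg L) p^`()) r.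
rewrite map_poly_eq0 p'_neq0 size_map_poly deg_r rootE dE z eqxx.
have -> : map_poly (in_alg L) p^`() \is a polyOver 1%AS.
  by apply/polyOver1P; exists p^`().
have := lt_size_deriv (irredp_neq0 irr_p); rewrite szp ltnNge => /negP le4.
by move=> /(_ isT isT isT).
Qed.

Let discE : ((r - s) * (r - t) * (s - t)) ^+ 2 = (cubic_disc u v w)%:A.
Proof.
have -> := cubic_prod_disc (etrans (esym (map_cubic _ _ _ _)) pE).
rewrite -[RHS]/(in_alg L _) /cubic_disc; ring.
Qed.

(* (r - s)(r - t) lies in F(r), and multiplied by s - t it becomes +-d, so    *)
(* s - t is in F(r) as well as s + t.                                         *)
Lemma cubic_disc_square d :
  2%:R != 0 :> F -> cubic_disc u v w = d ^+ 2 ->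
  (r - s) * (r - t) != 0 -> s \in <<1; r>>%VS.
Proof.
move=> two_neq0F dE nz; have [uE vE] := coefE.
have Kden : (r - s) * (r - t) \in K.
  (* The right side is p'(r) in terms of the coefficients of p. *)
  have -> : (r - s) * (r - t) = 3%:R * r ^+ 2 + 2%:R * u%:A * r + v%:A.
    by rewrite uE vE; ring.
  by rewrite !rpredD ?rpredM ?rpredX ?rpred_nat ?A_K.
have Kdelta : (r - s) * (r - t) * (s - t) \in K.
  have : ((r - s) * (r - t) * (s - t)) ^+ 2 == (d%:A) ^+ 2.
    by rewrite discE dE -!in_algE rmorphXn.
  by rewrite eqf_sqr => /orP[] /eqP->; rewrite ?rpredN A_K.
have two_neq0 : 2%:R != 0 :> L by rewrite -(rmorph_nat (in_alg L)) fmorph_eq0.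
have -> : s = ((s + t) + (r - s) * (r - t) * (s - t) / ((r - s) * (r - t))) / 2%:R.
  by move: nz; rewrite mulf_eq0 negb_or => /andP[rs rt]; field;
    rewrite rs rt two_neq0.
by rewrite rpredM ?rpredV ?rpred_nat // rpredD // rpredM ?rpredV.
Qed.

(** [delta] and [- delta] have sum 0 and product in F; degree 1 would make [delta] a square root of
    the discriminant in F. *)
Lemma cubic_disc_nonsquare :
  (forall d, cubic_disc u v w <> d ^+ 2) -> (2 %| \dim {: L})%N.
Proof.
move=> nsq; set delta := (r - s) * (r - t) * (s - t).
have: (\dim <<1; delta>> %| \dim {: L})%N.
  by apply: (@field_dimS _ _ _ {: L}%AS); exact: subvf.
rewrite (dim_Fadjoin 1%AS) dimv1 muln1 (@adjoin_degree_quadratic _ _ _ _ (- delta)).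
- case: ifP => // /vlineP[d dE]; case: (nsq d); apply: (fmorph_inj (in_alg L)).
  by rewrite /= -discE -/delta dE -!in_algE rmorphXn.
- by rewrite subrr mem0v.
- by rewrite mulrN -expr2 discE rpredN A_K.
Qed.

End CubicSplittingField.

Lemma irreducible_cubic_splitting_degree (u v w : rat) :
    irreducible_poly (cubic u v w) ->
  ((exists d, cubic_disc u v w = d ^+ 2) ->
     splitting_field_degree (cubic u v w) 3)
  /\ ((forall d, cubic_disc u v w <> d ^+ 2) ->
     splitting_field_degree (cubic u v w) 6).
Proof.
move=> irr_p.
have root_L L (splL : is_splitting_field (cubic u v w) L) :
    exists x, root (map_poly (in_alg L) (cubic u v w)) x.
  by apply: splitting_field_root splL; rewrite size_map_poly size_cubic.
split=> disc; (split; first exact/splitting_field_exists/monic_cubic) => L splL.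
  have [x px0] := root_L L splL.
  have [s [t [pE gen]]] := cubic_splitting_roots splL px0.
  have [d dE] := disc; rewrite (dim_cubic_splitting pE gen).
  rewrite (cubic_disc_square pE _ dE) ?(irreducible_cubic_simple_root pE) //.
  by rewrite (dim_adjoin_irreducible irr_p px0) size_cubic.
have [x px0] := root_L L splL.
have [s [t [pE gen]]] := cubic_splitting_roots splL px0.
have := cubic_disc_nonsquare pE disc; rewrite (dim_cubic_splitting pE gen).
by rewrite (dim_adjoin_irreducible irr_p px0) size_cubic; case: ifP.
Qed.

(** Adjoining the rational root c adds nothing, so the degree is 1 or 2, and it is even. *)
Lemma cubic_rational_root_splitting_degree (u v w c : rat) :
    root (cubic u v w) c -> (forall d, cubic_disc u v w <> d ^+ 2) ->
  splitting_field_degree (cubic u v w) 2.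
Proof.
move=> pc0 disc; (split; first exact/splitting_field_exists/monic_cubic) => L splL.
have px0 : root (map_poly (in_alg L) (cubic u v w)) c%:A.
  by rewrite -in_algE fmorph_root.
have [s [t [pE gen]]] := cubic_splitting_roots splL px0.
have := cubic_disc_nonsquare pE disc; rewrite (dim_cubic_splitting pE gen).
have -> : <<1; c%:A>>%VS = 1%VS :> {vspace L}.
  by apply/(@Fadjoin_idP _ _ 1%AS); rewrite rpredZ ?mem1v.
by rewrite dimv1; case: ifP.
Qed.

(** * Arithmetic of [chi_cubic] *)

Lemma int_sqrt_rat (k : int) (d : rat) :
  d ^+ 2 = k%:~R -> exists m : int, d = m%:~R.
Proof.
move=> dE; apply/intrP; apply: (@root_int ('X^2 - (k%:~R)%:P)).
- exact: monicXnsubC.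
- apply/polyOverP=> i; rewrite coefB coefXn coefC rpredB ?rpred_nat //.
  by case: ifP => _; rewrite ?rpred0 ?intr_int.
- by rewrite rootE !hornerE dE subrr.
Qed.

Section ChiCubic.

Variables a b : nat.
Hypotheses (a_gt0 : (0 < a)%N) (b_gt0 : (0 < b)%N).

Let chi := chi_cubic (a + b + 1) b.
Let u : rat := 2 - a%:R - b%:R.
Let v : rat := a%:R * b%:R - 2 * a%:R - 2 * b%:R + 1.
Let w : rat := 2 * a%:R * b%:R - a%:R - b%:R.

Let chiE : chi = cubic u v w.
Proof. by rewrite /chi /chi_cubic /cubic /u /v /w -!mul_polyC; ring. Qed.

Let size_chi : size chi = 4.
Proof. by rewrite chiE size_cubic. Qed.

Let coef_int : [/\ u \is a Num.int, v \is a Num.int & w \is a Num.int].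
Proof.
by split; rewrite /u /v /w ?(rpredB, rpredD, rpredM, rpred_nat, rpred1).
Qed.

Lemma monic_chi_cubic : chi \is monic.
Proof. by rewrite chiE monic_cubic. Qed.

Lemma horner_chi_cubic x : chi.[x]
  = (x + 1) ^+ 3 - (a%:R + b%:R + 1) * (x + 1) ^+ 2 + a%:R * b%:R * (x + 1)
    + a%:R * b%:R.
Proof. by rewrite chiE horner_cubic /u /v /w; ring. Qed.

(** The value at -1 is ab; its nonvanishing makes the multiplicity of -1 exactly n - 3. *)
Lemma rootN1_chi_cubic : ~~ root chi (-1).
Proof.
rewrite rootE horner_chi_cubic addNr !expr0n /= !mulr0 subr0 !add0r.
by rewrite mulf_neq0 // pnatr_eq0 -lt0n.
Qed.

Lemma rational_root_chi_cubic x : root chi x -> a = b.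
Proof.
have [intu intv intw] := coef_int.
move=> chix0; have /intrP[k xE] : x \is a Num.int.
  apply: root_int chix0; rewrite chiE ?monic_cubic //.
  apply/polyOverP=> i; rewrite coef_cubic.
  by do 3!case: ifP => _ //; rewrite rpred_nat.
suff /eqP : (a : int) = b by rewrite eqz_nat => /eqP.
apply: (@shifted_cubic_int_root _ _ (k + 1)); rewrite ?ltz_nat //.
apply: (@intr_inj rat); move: chix0; rewrite rootE horner_chi_cubic xE => /eqP E.
by transitivity (0 : rat); rewrite // -[RHS]E; ring.
Qed.

Lemma chi_cubic_irreducible : a <> b -> irreducible_poly chi.
Proof.
move=> a_neq_b; apply: cubic_irreducible; first by rewrite size_chi.
by move=> x; apply/negP => /rational_root_chi_cubic.
Qed.

(** The discriminant is an integer, so a rational square root of it is an integer. *)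
Lemma square_in_Z_discriminant :
  square_in_Z (discriminant chi) <-> exists d, cubic_disc u v w = d ^+ 2.
Proof.
rewrite chiE discriminant_cubic; split=> [[k] | [d dE]].
  rewrite -(ratr_int algC) -rmorphXn => /fmorph_inj dE.
  by exists k%:~R.
have [intu intv intw] := coef_int.
have /intrP[D DE] : cubic_disc u v w \is a Num.int.
  by rewrite /cubic_disc ?(rpredB, rpredD, rpredM, rpredX, rpred_nat).
have [k kE] : exists k : int, d = k%:~R by apply: (@int_sqrt_rat D); rewrite -dE.
by exists k; rewrite dE kE rmorphXn /= ratr_int.
Qed.

Lemma chi_cubic_splitting_degree : a <> b ->
  (square_in_Z (discriminant chi) -> splitting_field_degree chi 3)
  /\ (~ square_in_Z (discriminant chi) -> splitting_field_degree chi 6).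
Proof.
move=> /chi_cubic_irreducible irr; rewrite !square_in_Z_discriminant.
rewrite chiE in irr *.
have [deg3 deg6] := irreducible_cubic_splitting_degree irr; split=> // nsq.
by apply: deg6 => d dE; case: nsq; exists d.
Qed.

Hypothesis ab : a = b.

Lemma chi_cubic_factor :
  chi = ('X - (b%:R - 1)%:P) * ('X^2 - (b%:R - 1) *: 'X - (2 * b%:R)%:P).
Proof. by rewrite chiE /cubic /u /v /w ab -!mul_polyC; ring. Qed.

Lemma reducible_chi_cubic : reducible_poly chi.
Proof.
exists ('X - (b%:R - 1)%:P), ('X^2 - (b%:R - 1) *: 'X - (2 * b%:R)%:P).
split; [by rewrite size_XsubC | | exact: chi_cubic_factor].
have := size_chi; rewrite chi_cubic_factor; set q := (X in _ * X) => szq.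
have q_neq0 : q != 0 by apply/eqP=> q0; rewrite q0 mulr0 size_poly0 in szq.
move: szq; rewrite size_monicM ?monicXsubC // size_XsubC.
by rewrite addSn /= add1n => -[->].
Qed.

Lemma chi_cubic_quadratic_splitting : splitting_field_degree chi 2.
Proof.
rewrite chiE; apply: (@cubic_rational_root_splitting_degree _ _ _ (b%:R - 1)).
  by rewrite -chiE chi_cubic_factor rootM root_XsubC eqxx.
move=> d dE; have b_neq0 : b%:R != 0 :> rat by rewrite pnatr_eq0 -lt0n.
have sqE : (d / (2 * b%:R)) ^+ 2 = ((b%:R + 3) ^+ 2 - 8 : int)%:~R.
  by rewrite expr_div_n -dE /cubic_disc /u /v /w ab; field.
have [k kE] := int_sqrt_rat sqE.
move: sqE; rewrite kE -rmorphXn => /intr_inj; rewrite -real_normK ?num_real //.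
have : 0 <= `|k| by []; have : 4 <= b%:R + 3 :> int by lia.
rewrite !expr2; move: (b%:R + 3) `|k| => m j m_ge4 j_ge0 jE.
(* Now j^2 = m^2 - 8. From j <= m - 1 follows 2m <= 9, hence m = 4 and j^2 = 8, which is
   impossible. *)
have jm : j < m.
  rewrite ltNge; apply/negP=> mj.
  have : m * m <= j * j by apply: ler_pM; lia.
  lia.
have jjE : j * j <= (m - 1) * (m - 1) by apply: ler_pM; lia.
have mE : m = 4 by lia.
rewrite mE in jE; have [j2 | j3] := lerP j 2.
  have : j * j <= 2 * 2 by apply: ler_pM; lia.
  lia.
have : 3 * 3 <= j * j by apply: ler_pM; lia.
lia.
Qed.

End ChiCubic.

Lemma reducible_poly_not_irreducible (p : {poly rat}) :
  reducible_poly p -> ~ irreducible_poly p.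
Proof.
case=> q [r [q_gt1 r_gt1 pE]] irr.
have q_neq0 : q != 0 by rewrite -size_poly_gt0 ltnW.
have r_neq0 : r != 0 by rewrite -size_poly_gt0 ltnW.
have qp : q %= p by apply: (apply_irredp irr); rewrite ?pE ?dvdp_mulr // gtn_eqF.
move/eqp_size: qp; rewrite pE size_mul //.
by move: q_gt1 r_gt1; case: (size q) => // m; case: (size r) => // k; lia.
Qed.

Theorem theorem3p4 (n n1 l1 l3 : nat) (gT : finGroupType) (G : {group gT})
    (n_ge3 : (3 <= n)%N) (n1_ge1 : (1 <= n1)%N)
    (n1_le : (n1 <= n - (n1 + 1))%N)
    (l1E : l1 = (n - (n1 + 1))%N) (l3E : l3 = n1)
    (solG : solvable G)
    (isoG : graph_iso (degree_graph G)
              (join (complete 1) (disjoint_union (complete l1) (complete l3)))) :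
  let A := adjacency_mx (degree_graph G) in
  let chi := chi_cubic n n1 in
  [/\ (* (i) *)
      mup (-1) (char_poly A) = (n - 3)%N,
      (* (ii) *)
      perm_eq (eigenvalues A) (nseq (n - 3) (-1) ++ complex_roots chi)
      /\ char_poly A = ('X + 1) ^+ (n - 3) * chi,
      (* (iii) *)
      (reducible_poly chi <-> n = (2 * n1 + 1)%N)
      /\ (n = (2 * n1 + 1)%N ->
          chi = ('X - (n1%:R - 1)%:P)
                * ('X^2 - (n1%:R - 1) *: 'X - (2 * n1%:R)%:P)
          /\ splitting_field_degree chi 2),
      (* (iv) *)
      (n <> (2 * n1 + 1)%N -> irreducible_poly chi)
    & (* (v) *)
      (n <> (2 * n1 + 1)%N ->
         (square_in_Z (discriminant chi) -> splitting_field_degree chi 3)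
         /\ (~ square_in_Z (discriminant chi) -> splitting_field_degree chi 6))].
Proof.
move=> A chi; subst l3.
(* Writing n as a + n1 + 1 with a = l1 removes the truncated subtractions. *)
have [a [a_gt0 nE]] : exists a, (0 < a)%N /\ n = (a + n1 + 1)%N.
  by exists l1; split; lia.
have l1a : l1 = a by lia.
have n2E : n = (2 * n1 + 1)%N <-> a = n1 by lia.
rewrite l1a in isoG; clear l1E l1a n1_le.
have charA : char_poly A = ('X + 1) ^+ (n - 3) * chi.
  by rewrite /chi nE; apply: char_poly_bowtieE isoG; lia.
have X1 : 'X + 1 = 'X - (-1)%:P :> {poly rat} by rewrite polyCN opprK.
subst n; rewrite -/chi in charA *; split.
- by rewrite charA mupMl ?rootN1_chi_cubic // X1 mup_XsubCX eqxx.
(* Eigenvalues are listed with multiplicity, so it suffices to compare products of linear factors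
   over [algC]. *)
- split=> //; apply: perm_complex_roots; first exact: char_poly_monic.
  rewrite charA rmorphM rmorphXn /= big_cat /= -complex_roots_prod;
    last exact: monic_chi_cubic.
  rewrite big_nseq iter_mulr_1; congr (_ ^+ _ * _).
  by rewrite X1 map_polyXsubC rmorphN1.
- split.
    split=> [red | /n2E]; last by move=> ?; apply: reducible_chi_cubic.
    apply/n2E; have [//|/eqP a_neq] := eqVneq a n1.
    case: (reducible_poly_not_irreducible red).
    exact: chi_cubic_irreducible.
  move=> /n2E aE; split; first exact: chi_cubic_factor.
  exact: chi_cubic_quadratic_splitting.
- by move=> ne; apply: chi_cubic_irreducible => // /n2E.
- by move=> ne; apply: chi_cubic_splitting_degree => // /n2E.
Qed.
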